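(* Let $A=(g,F)\in\mathcal{R}(\mathbb{F})$ with $g=\sum_{n\ge0}g_nx^n\in\mathcal{F}_0$ and $F=\sum_{n\ge1}f_nx^n\in\mathcal{F}_1$. Then the following statements are equivalent: (a) $A$ has a full set of eigenvectors, i.e. $A\in\mathcal{R}_{\rm full}$. (b) $A$ has two linearly independent eigenvectors. (c) $A$ has an eigenvector of level $k$ for some $k>0$, and there exists $\theta\in\mathcal{F}_1$ such that $(\theta\circ F\circ\overline{\theta})(x)=f_1x$. (d) $A$ has a primary eigenvector, and there exists $\theta\in\mathcal{F}_1$ such that $(\theta\circ F\circ\overline{\theta})(x)=f_1x$. (e) $A$ is conjugate to the diagonal matrix $(g_0,f_1x)$ by a Riordan matrix: there is $(h,\theta)\in\mathcal{R}(\mathbb{F})$ such that $(h,\theta)^{-1}(g,F)(h,\theta)=(g_0,f_1x)$. (f) $A$ has an eigenvector of level $k$ for some $k\ge0$, and either $F$ has finite compositional order in $\mathcal{F}_1$ or $f_1$ has infinite multiplicative order in $\mathbb{F}$. (g) With $\widehat{g}:=\frac{1}{g_0}g(x)\in\mathcal{F}_0$: either $f_1$ has infinite multiplicative order in $\mathbb{F}\setminus\{0\}$, or $(\widehat{g},F)$ is a finite order element of the group $\mathcal{R}(\mathbb{F})$ of order equal to the order of $f_1$.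
   Context: $\mathbb{F}$ is the field of real or complex numbers. $\mathcal{F}_0$ is the set of formal power series in $\mathbb{F}[[x]]$ with nonzero constant term, and $\mathcal{F}_1=x\mathcal{F}_0$, which is a group under composition; $\overline{\theta}$ denotes the compositional inverse of $\theta\in\mathcal{F}_1$. For $g\in\mathcal{F}_0$, $F\in\mathcal{F}_1$, the Riordan matrix $(g,F)$ is the infinite lower triangular matrix $[a_{ij}]_{i,j\ge0}$ with $a_{ij}=[x^i]\,g(x)F(x)^j$. The set $\mathcal{R}(\mathbb{F})$ of all Riordan matrices over $\mathbb{F}$ is a group under matrix multiplication, with $(g,F)(h,L)=(g\cdot h(F),L(F))$ and identity $(1,x)$. An eigenvector of $A\in\mathcal{R}(\mathbb{F})$ is a nonzero vector ${\bf h}=(h_0,h_1,\ldots)^T\in\mathbb{F}^{\mathbb{N}_0}$ with $A{\bf h}=\lambda{\bf h}$ for some $\lambda\in\mathbb{F}$; equivalently, with $h(x)=\sum h_nx^n$, $g(x)h(F(x))=\lambda h(x)$. An eigenvector has level $k$ if it has the form $(0,\ldots,0,h_k,h_{k+1},\ldots)^T$ with $h_k\neq0$ (its eigenvalue is then $g_0f_1^k$); an eigenvector of level $0$ is called primary. A full set of eigenvectors is a set $\{{\bf h}_0,{\bf h}_1,\ldots\}$ of eigenvectors with ${\bf h}_k$ of level $k$ for every $k\ge0$, and $\mathcal{R}_{\rm full}$ is the set of Riordan matrices having a full set of eigenvectors. The compositional order of $F\in\mathcal{F}_1$ is the smallest positive integer $n$ with $F^{(n)}(x)=x$ ($n$-fold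 composition), and is infinite if no such $n$ exists; the multiplicative order of $a\in\mathbb{F}\setminus\{0\}$ is the smallest positive integer $n$ with $a^n=1$, and is infinite if no such $n$ exists. *)

(* Defs.v *)
From HB Require Import structures.
From mathcomp Require Import all_boot all_order all_algebra.
From mathcomp Require Import boolp reals complex.

Set Implicit Arguments.
Unset Strict Implicit.
Unset Printing Implicit Defensive.

Import GRing.Theory.
Local Open Scope ring_scope.

Variant real_or_complex : fieldType -> Prop :=
| IsReal (R : realType) : real_or_complex (R : fieldType)
| IsComplex (R : realType) : real_or_complex (R[i] : fieldType).

(* Formal power series: [f n] is the coefficient of [x^n] in [f]. *)
Record fps (K : Type) := Fps { coefs :> nat -> K }.

Lemma fpsP (K : Type) (f g : fps K) : f =1 g -> f = g.
Proof. by case: f g => [f] [g] /= /funext ->. Qed.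

HB.instance Definition _ (K : Type) := gen_eqMixin (fps K).
HB.instance Definition _ (K : Type) := gen_choiceMixin (fps K).

Section FpsRing.
Variable K : comNzRingType.
Implicit Types f g h : fps K.

Definition fps_zero : fps K := Fps (fun=> 0).
Definition fps_opp f : fps K := Fps (fun n => - f n).
Definition fps_add f g : fps K := Fps (fun n => f n + g n).
Definition fpsC (c : K) : fps K := Fps (fun n => if n == 0%N then c else 0).
Definition fps_mul f g : fps K :=
  Fps (fun n => \sum_(i < n.+1) f i * g (n - i)%N).

Fact fps_addA : associative fps_add.
Proof. by move=> f g h; apply: fpsP => n /=; rewrite addrA. Qed.
Fact fps_addC : commutative fps_add.
Proof. by move=> f g; apply: fpsP => n /=; rewrite addrC. Qed.
Fact fps_add0 : left_id fps_zero fps_add.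
Proof. by move=> f; apply: fpsP => n /=; rewrite add0r. Qed.
Fact fps_addN : left_inverse fps_zero fps_opp fps_add.
Proof. by move=> f; apply: fpsP => n /=; rewrite addNr. Qed.

HB.instance Definition _ :=
  GRing.isZmodule.Build (fps K) fps_addA fps_addC fps_add0 fps_addN.

Definition fps_trunc N f : {poly K} := \poly_(i < N.+1) f i.

Lemma fps_truncE N f i : (i <= N)%N -> (fps_trunc N f)`_i = f i.
Proof. by move=> iN; rewrite coef_poly ltnS iN. Qed.

Lemma fps_mulE N f g n : (n <= N)%N ->
  fps_mul f g n = (fps_trunc N f * fps_trunc N g)`_n.
Proof.
move=> nN; rewrite coefM /=; apply: eq_bigr => i _.
have iN : (i <= N)%N by rewrite (leq_trans _ nN) // -ltnS.
by rewrite !fps_truncE // (leq_trans (leq_subr _ _) nN).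
Qed.

Fact fps_mulA : associative fps_mul.
Proof.
move=> f g h; apply: fpsP => n.
transitivity ((fps_trunc n f * (fps_trunc n g * fps_trunc n h))`_n).
  rewrite coefM; apply: eq_bigr => i _; have iN : (i <= n)%N by rewrite -ltnS.
  by rewrite fps_truncE // (@fps_mulE n) ?leq_subr.
rewrite mulrA coefM; apply: eq_bigr => i _.
have iN : (i <= n)%N by rewrite -ltnS.
by rewrite fps_truncE ?leq_subr // -fps_mulE.
Qed.

Fact fps_mulC : commutative fps_mul.
Proof.
by move=> f g; apply: fpsP => n; rewrite !(@fps_mulE n) // mulrC.
Qed.

Fact fps_mul1 : left_id (fpsC 1) fps_mul.
Proof.
move=> f; apply: fpsP => n /=; rewrite big_ord_recl /= mul1r subn0.
by rewrite big1 ?addr0 // => i _; rewrite mul0r.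
Qed.

Fact fps_mulDl : left_distributive fps_mul fps_add.
Proof.
move=> f g h; apply: fpsP => n /=; rewrite -big_split.
by apply: eq_bigr => i _; rewrite mulrDl.
Qed.

Fact fps_one_neq0 : fpsC 1 != 0 :> fps K.
Proof.
apply/eqP => /(congr1 (fun f : fps K => f 0%N)) /= e.
by have := oner_neq0 K; rewrite e eqxx.
Qed.

HB.instance Definition _ := GRing.Zmodule_isComNzRing.Build (fps K)
  fps_mulA fps_mulC fps_mul1 fps_mulDl fps_one_neq0.

Definition fpsX : fps K := Fps (fun n => (n == 1%N)%:R).

(* [h(F(x))]; since it is only used when [F 0 = 0], the powers [F ^+ j] with
   [j > n] do not contribute to the coefficient of [x^n]. *)
Definition fps_comp h F : fps K :=
  Fps (fun n => \sum_(j < n.+1) h j * coefs (F ^+ j) n).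

Definition fps_iter F n : fps K := iter n (fps_comp F) fpsX.

End FpsRing.

Arguments fpsX {K}.

Section Riordan.
Variable K : fieldType.
Implicit Types (f g h F : fps K) (A B : nat -> nat -> K) (v : nat -> K).

Definition inF0 g : Prop := g 0%N != 0.
Definition inF1 F : Prop := exists2 f, inF0 f & F = fpsX * f.

Definition comp_inverse F G : Prop :=
  fps_comp F G = fpsX /\ fps_comp G F = fpsX.

Definition riordan g F : nat -> nat -> K := fun i j => coefs (g * F ^+ j) i.

Definition is_riordan A : Prop :=
  exists g F, [/\ inF0 g, inF1 F & A = riordan g F].

(* Products with an infinite lower triangular left factor [A]: row [i] of [A]
   vanishes beyond column [i], so the sums stop at [i]. *)
Definition ltmx_mul A B : nat -> nat -> K :=
  fun i k => \sum_(j < i.+1) A i j * B j k.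
Definition ltmx_app A v : nat -> K :=
  fun i => \sum_(j < i.+1) A i j * v j.

Definition mx_id : nat -> nat -> K := fun i j => (i == j)%:R.
Definition ltmx_exp A n : nat -> nat -> K := iter n (ltmx_mul A) mx_id.

Definition riordan_inverse A B : Prop :=
  [/\ is_riordan B, ltmx_mul A B = mx_id & ltmx_mul B A = mx_id].

Definition eigenvector A v : Prop :=
  (exists n, v n != 0) /\
  exists lambda : K, forall i, ltmx_app A v i = lambda * v i.

Definition has_level k v : Prop :=
  (forall i, (i < k)%N -> v i = 0) /\ v k != 0.

Definition level_eigenvector A k v : Prop := eigenvector A v /\ has_level k v.
Definition primary_eigenvector A v : Prop := level_eigenvector A 0 v.

Definition full_set_of_eigenvectors A : Prop :=
  exists v : nat -> nat -> K, forall k, level_eigenvector A k (v k).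

Definition lin_indep2 u v : Prop :=
  forall a b : K, (forall i, a * u i + b * v i = 0) -> a = 0 /\ b = 0.

(* The order of an element, in terms of [P n := "its n-th power is trivial"]. *)
Definition is_order (P : nat -> Prop) (n : nat) : Prop :=
  [/\ (0 < n)%N, P n & forall m, (0 < m)%N -> P m -> (n <= m)%N].
Definition infinite_order (P : nat -> Prop) : Prop :=
  ~ exists n, (0 < n)%N /\ P n.

Definition mul_trivial (a : K) (n : nat) : Prop := a ^+ n = 1.
Definition comp_trivial F (n : nat) : Prop := fps_iter F n = fpsX.
Definition mx_trivial A (n : nat) : Prop := ltmx_exp A n = mx_id.

Definition linearizable F : Prop :=
  exists theta thetabar, [/\ inF1 theta, inF1 thetabar,
    comp_inverse theta thetabar &
    fps_comp theta (fps_comp F thetabar) = fpsC (F 1%N) * fpsX].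

End Riordan.

(* Main.v *)
Require Import Defs.
From HB Require Import structures.
From mathcomp Require Import all_boot all_order all_algebra.
From mathcomp Require Import ring.
From mathcomp Require Import boolp reals complex.
Set Implicit Arguments.
Unset Strict Implicit.
Unset Printing Implicit Defensive.

Import GRing.Theory.
Local Open Scope ring_scope.

(** Write [f_1 = F 1] and [g_0 = g 0], and let [(g, F)] act on series by
    [h |-> g * h(F)].  Comparing lowest-order terms, an eigenvector of level [k]
    is a series [h] starting in degree [k] with [g * h(F) = g_0 f_1^k h].

    The equivalences rest on three facts.

    - Rigidity ([fixed_series_comp_id]): in characteristic zero, if
      [G = x + O(x^2)] and [w(G) = w] for some [w] of level [d > 0], then
      [G = x].  Hence if [w(F) = f_1^d w] and [f_1^m = 1], the [m]-th iterate of
      [F] is [x], because it fixes [w] and has linear coefficient [f_1^m = 1].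

    - Averaging ([finite_order_level_eigen]): if [g_0 = 1] and [(g, F)^m = 1],
      then the sum of [f_1^(-ki) (g, F)^i x^k] over [i < m] is an eigenvector of
      level [k]; its leading coefficient is [m].

    - Triangular solving ([infinite_order_level_eigen]): if [f_1] has infinite
      order, the diagonal entries [g_0 f_1^n] of [(g, F)] are distinct, so there
      is an eigenvector of every level.

    Eigenvectors multiply: the quotient of eigenvectors of levels [j < k] is a
    series [w] of level [d = k - j] with [w(F) = f_1^d w].  Then [F] is
    linearizable, that is, [theta(F) = f_1 theta] for some [theta] of level 1:
    apply averaging (through rigidity) or triangular solving to [(1, F)],
    according to whether the order of [f_1] is finite.  Conversely, dividing an
    eigenvector of level [k] by [theta^k] gives a primary one [h], and the two
    equations [g * h(F) = g_0 h] and [theta(F) = f_1 theta] say that [(h, theta)]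
    conjugates [(g, F)] to [(g_0, f_1 x)].  Finally, an eigenvector [v] of level
    [k] writes [g / g_0] as [f_1^k v / v(F)], so that the product giving
    [(g / g_0, F)^m] telescopes to [f_1^(km) v / v = 1] when the [m]-th iterate
    of [F] is [x] and [f_1^m = 1]. *)

(** * Coefficients of formal power series *)

Section Coefficients.
Variable K : comNzRingType.
Implicit Types f g h F G : fps K.

Lemma coef_fpsM f g n : (f * g) n = \sum_(i < n.+1) f i * g (n - i)%N.
Proof. by []. Qed.

Lemma coef_fpsD f g n : (f + g) n = f n + g n.
Proof. by []. Qed.

Lemma coef_fpsN f n : (- f) n = - f n.
Proof. by []. Qed.

Lemma coef_fps1 n : (1 : fps K) n = (n == 0%N)%:R.
Proof. by rewrite /=; case: eqP. Qed.

Lemma coef_fps_sum (I : Type) (r : seq I) (P : pred I) (f : I -> fps K) n :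
  (\sum_(i <- r | P i) f i) n = \sum_(i <- r | P i) (f i) n.
Proof. exact: (big_morph (fun f : fps K => f n)). Qed.

Lemma coef0_fpsM f g : (f * g) 0%N = f 0%N * g 0%N.
Proof. by rewrite coef_fpsM big_ord1. Qed.

Lemma coef_fpsCM (c : K) f n : (fpsC c * f) n = c * f n.
Proof.
rewrite coef_fpsM big_ord_recl /= subn0 big1 ?addr0 // => i _.
by rewrite mul0r.
Qed.

Lemma coef_fpsXM f n : (fpsX * f) n = if n is n'.+1 then f n' else 0.
Proof.
case: n => [|n]; first by rewrite coef0_fpsM /= mul0r.
rewrite coef_fpsM 2!big_ord_recl /= mul0r add0r mul1r subn1 /=.
by rewrite big1 ?addr0 // => i _; rewrite mul0r.
Qed.

Lemma coef_fpsXnM k f n :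
  (fpsX ^+ k * f) n = if (n < k)%N then 0 else f (n - k)%N.
Proof.
elim: k n => [|k IHk] n; first by rewrite expr0 mul1r subn0.
by rewrite exprS -mulrA coef_fpsXM; case: n => // n; rewrite IHk ltnS subSS.
Qed.

Lemma coef_fpsXn k n : (fpsX ^+ k : fps K) n = (n == k)%:R.
Proof.
rewrite -[_ ^+ k]mulr1 coef_fpsXnM coef_fps1.
case: ltnP => nk; first by rewrite (ltn_eqF nk).
by rewrite subn_eq0 eqn_leq nk andbT.
Qed.

Fact fpsC_zmod_morphism : zmod_morphism (@fpsC K).
Proof. by move=> a b; apply: fpsP => -[|n] //=; rewrite subr0. Qed.

Fact fpsC_monoid_morphism : monoid_morphism (@fpsC K).
Proof.
split=> // a b; apply: fpsP => n; rewrite coef_fpsCM /=.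
by case: eqP => // _; rewrite mulr0.
Qed.

HB.instance Definition _ :=
  GRing.isZmodMorphism.Build K (fps K) (@fpsC K) fpsC_zmod_morphism.
HB.instance Definition _ :=
  GRing.isMonoidMorphism.Build K (fps K) (@fpsC K) fpsC_monoid_morphism.

Lemma fpsX_mulE F : F 0%N = 0 -> exists f, F = fpsX * f.
Proof.
move=> F0; exists (Fps (fun n => F n.+1)); apply: fpsP => -[|n].
  by rewrite coef_fpsXM.
by rewrite coef_fpsXM.
Qed.

Lemma fpsXn_mulE k f : (forall i, (i < k)%N -> f i = 0) ->
  f = fpsX ^+ k * Fps (fun n => f (n + k)%N).
Proof.
move=> f_lt; apply: fpsP => n; rewrite coef_fpsXnM.
by case: ltnP => [/f_lt //|kn]; rewrite /= subnK.
Qed.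

Lemma coef_fps_expn_lt F j n : F 0%N = 0 -> (n < j)%N -> (F ^+ j) n = 0.
Proof. by case/fpsX_mulE=> f -> nj; rewrite exprMn coef_fpsXnM nj. Qed.

Lemma coef_fps_expn_diag F n : F 0%N = 0 -> (F ^+ n) n = F 1%N ^+ n.
Proof.
case/fpsX_mulE=> f ->; rewrite exprMn coef_fpsXnM ltnn subnn coef_fpsXM.
by elim: n => [|n IHn]; rewrite ?expr0 // !exprS coef0_fpsM IHn.
Qed.

End Coefficients.

(** * Composition *)

Section Composition.
Variable K : comNzRingType.
Implicit Types (f g h F G : fps K) (p q : {poly K}).

(** The coefficient of [x^n] in [h(F)] does not depend on where the sum over the
    powers of [F] is cut, as long as it is beyond [n]. *)
Lemma sum_coef_expn_widen F (c : nat -> K) n N : F 0%N = 0 -> (n < N)%N ->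
  \sum_(j < N) c j * (F ^+ j) n = \sum_(j < n.+1) c j * (F ^+ j) n.
Proof.
move=> F0 nN; rewrite [RHS](big_ord_widen N (fun j => c j * (F ^+ j) n)) //.
rewrite [RHS]big_mkcond; apply: eq_bigr => j _; case: ifPn => //.
by rewrite -leqNgt => nj; rewrite coef_fps_expn_lt // mulr0.
Qed.

Lemma coef_fps_comp h F n N : F 0%N = 0 -> (n < N)%N ->
  (fps_comp h F) n = \sum_(j < N) h j * (F ^+ j) n.
Proof. by move=> F0 nN; rewrite sum_coef_expn_widen. Qed.

(** Substitution in a polynomial is a ring morphism; composition inherits
    multiplicativity from it by truncation. *)
Lemma coef_horner_fps p F n : F 0%N = 0 ->
  (map_poly (@fpsC K) p).[F] n = \sum_(j < n.+1) p`_j * (F ^+ j) n.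
Proof.
move=> F0; rewrite (horner_coef_wide _ (n := maxn n.+1 (size p))); last first.
  by rewrite (leq_trans (size_poly _ _)) ?leq_maxr.
rewrite coef_fps_sum.
rewrite -(sum_coef_expn_widen (fun j => p`_j) F0 (leq_maxl _ (size p))).
by apply: eq_bigr => j _; rewrite coef_map coef_fpsCM.
Qed.

Lemma fps_comp_horner h F n N : F 0%N = 0 -> (n <= N)%N ->
  (fps_comp h F) n = (map_poly (@fpsC K) (fps_trunc N h)).[F] n.
Proof.
move=> F0 nN; rewrite coef_horner_fps //; apply: eq_bigr => j _.
by rewrite fps_truncE // (leq_trans _ nN) // -ltnS.
Qed.

Lemma fps_compM h1 h2 F : F 0%N = 0 ->
  fps_comp (h1 * h2) F = fps_comp h1 F * fps_comp h2 F.
Proof.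
move=> F0; apply: fpsP => n.
transitivity ((map_poly (@fpsC K) (fps_trunc n h1 * fps_trunc n h2)).[F] n).
  rewrite coef_horner_fps //; apply: eq_bigr => j _; congr (_ * _).
  by rewrite -fps_mulE // -ltnS.
rewrite rmorphM hornerM !coef_fpsM; apply: eq_bigr => i _.
by rewrite -!fps_comp_horner ?leq_subr // -ltnS.
Qed.

Lemma fps_compD h1 h2 F : fps_comp (h1 + h2) F = fps_comp h1 F + fps_comp h2 F.
Proof.
apply: fpsP => n; rewrite coef_fpsD /= -big_split.
by apply: eq_bigr => j _; rewrite mulrDl.
Qed.

Lemma fps_compC (c : K) F : fps_comp (fpsC c) F = fpsC c.
Proof.
apply: fpsP => n; rewrite /= big_ord_recl expr0 coef_fps1 /=.
rewrite big1 => [|i _]; last by rewrite mul0r.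
by case: n => [|n]; rewrite /= ?mulr1 ?mulr0 addr0.
Qed.

Lemma fps_comp1 F : fps_comp 1 F = 1.
Proof. exact: (fps_compC 1). Qed.

Lemma fps_compX F : F 0%N = 0 -> fps_comp fpsX F = F.
Proof.
move=> F0; apply: fpsP => -[|n].
  by rewrite /= big_ord1 mul0r F0.
rewrite /= 2!big_ord_recl mul0r add0r mul1r expr1 big1 ?addr0 // => i _.
by rewrite mul0r.
Qed.

Lemma fps_compfX h : fps_comp h fpsX = h.
Proof.
apply: fpsP => n; rewrite /= big_ord_recr /= big1 ?add0r => [|i _].
  by rewrite coef_fpsXn eqxx mulr1.
by rewrite coef_fpsXn gtn_eqF ?mulr0.
Qed.

Lemma fps_compXn h F k : F 0%N = 0 -> fps_comp (h ^+ k) F = fps_comp h F ^+ k.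
Proof.
move=> F0; elim: k => [|k IHk]; first exact: fps_comp1.
by rewrite !exprS fps_compM // IHk.
Qed.

Lemma fps_comp_sum (I : Type) (r : seq I) (P : pred I) (h : I -> fps K) F :
  fps_comp (\sum_(i <- r | P i) h i) F = \sum_(i <- r | P i) fps_comp (h i) F.
Proof.
apply: (big_morph (fun h => fps_comp h F)) => [h1 h2|]; first exact: fps_compD.
by rewrite -(rmorph0 (@fpsC K)) fps_compC.
Qed.

Lemma coef0_fps_comp h F : (fps_comp h F) 0%N = h 0%N.
Proof. by rewrite /= big_ord1 mulr1. Qed.

Lemma coef1_fps_comp h F : (fps_comp h F) 1%N = h 1%N * F 1%N.
Proof. by rewrite /= 2!big_ord_recl big_ord0 mulr0 add0r addr0. Qed.

Lemma fps_compA h F G : F 0%N = 0 -> G 0%N = 0 ->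
  fps_comp h (fps_comp F G) = fps_comp (fps_comp h F) G.
Proof.
move=> F0 G0; apply: fpsP => n.
have FG0 : (fps_comp F G) 0%N = 0 by rewrite coef0_fps_comp.
transitivity (\sum_(j < n.+1) \sum_(i < n.+1) h j * (F ^+ j) i * (G ^+ i) n).
  apply: eq_bigr => j _; rewrite -fps_compXn // mulr_sumr.
  by apply: eq_bigr => i _; rewrite mulrA.
rewrite exchange_big; apply: eq_bigr => i _; rewrite -mulr_suml.
by rewrite (@coef_fps_comp h F i n.+1).
Qed.

End Composition.

Lemma fps_iter0 (K : comNzRingType) (F : fps K) : fps_iter F 0 = fpsX.
Proof. by []. Qed.

Lemma fps_iterS (K : comNzRingType) (F : fps K) n :
  fps_iter F n.+1 = fps_comp F (fps_iter F n).
Proof. by []. Qed.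

Lemma fps_compE (K : comNzRingType) (h F : fps K) n :
  (fps_comp h F) n = \sum_(j < n.+1) h j * (F ^+ j) n.
Proof. by []. Qed.

(* From here on these operations are used through their equations only. *)
#[local] Opaque fps_mul fps_comp fps_iter.

(** * Triangular systems *)

Lemma triangular_solve (K : fieldType) (A : nat -> nat -> K) (b : nat -> K) :
  (forall n, A n n != 0) ->
  exists v : nat -> K, forall n, \sum_(j < n.+1) A n j * v j = b n.
Proof.
move=> Ann.
(* [s n] lists the first [n] entries of the solution, in order *)
pose s := fix s n := if n is n'.+1 then rcons (s n')
  ((A n' n')^-1 * (b n' - \sum_(j < n') A n' j * (s n')`_j)) else [::].
have size_s n : size (s n) = n by elim: n => //= n IHn; rewrite size_rcons IHn.
have s_nth n j : (j < n)%N -> (s n)`_j = (s j.+1)`_j.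
  elim: n => // n IHn; rewrite ltnS leq_eqVlt => /orP[/eqP -> //|jn].
  by rewrite [LHS]nth_rcons size_s jn IHn.
exists (fun n => (s n.+1)`_n) => n; rewrite big_ord_recr /=.
rewrite [X in A n n * X]nth_rcons size_s ltnn eqxx mulVKf //.
rewrite (eq_bigr (fun j : 'I_n => A n j * (s n)`_j)) => [|j _].
  by rewrite addrC subrK.
by rewrite [(s n)`_j]s_nth.
Qed.
(** * Levels and inverses *)

Section Levels.
Variable K : fieldType.
Implicit Types (f g h u F G : fps K).

Lemma inF1_level F : inF1 F <-> has_level 1 F.
Proof.
split=> [[f f0 ->]|[F0 F1]].
  split=> [[|//] _|]; first by rewrite coef_fpsXM.
  by rewrite coef_fpsXM.
by exists (Fps (fun n => F n.+1)); last by
  apply: fpsP => -[|n]; rewrite coef_fpsXM // F0.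
Qed.

Lemma inF1_coef0 F : inF1 F -> F 0%N = 0.
Proof. by case/inF1_level=> F0 _; exact: F0. Qed.

Lemma inF1_coef1 F : inF1 F -> F 1%N != 0.
Proof. by case/inF1_level. Qed.

Lemma has_level_ex f : f <> 0 -> exists k, has_level k f.
Proof.
move=> f_neq0; have fn : exists n, f n != 0.
  apply: contrapT => fn; apply: f_neq0; apply: fpsP => n.
  by apply/eqP; apply: contrapT => /negP fn0; apply: fn; exists n.
exists (ex_minn fn); case: ex_minnP => k fk k_min; split=> // i ik.
by apply/eqP; apply: contraLR ik => /k_min; rewrite -leqNgt.
Qed.

Lemma has_level_mulE k f : has_level k f ->
  exists2 u, inF0 u & f = fpsX ^+ k * u.
Proof.
case=> /fpsXn_mulE f_lt fk; by exists (Fps (fun n => f (n + k)%N)).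
Qed.

Lemma has_levelM k l f g : has_level k f -> has_level l g ->
  has_level (k + l) (f * g).
Proof.
case/has_level_mulE=> u u0 -> /has_level_mulE[v v0 ->].
rewrite mulrACA -exprD; split=> [i ikl|]; first by rewrite coef_fpsXnM ikl.
by rewrite coef_fpsXnM ltnn subnn coef0_fpsM mulf_neq0.
Qed.

Lemma has_levelXn l k f : has_level k f -> has_level (k * l) (f ^+ l).
Proof.
move=> fk; elim: l => [|l IHl]; last by rewrite exprS mulnS; apply: has_levelM.
by rewrite muln0; split=> //; rewrite coef_fps1 oner_neq0.
Qed.

(** [u * v = 1] is a triangular system in the coefficients of [v]. *)
Lemma inF0_inv u : inF0 u -> exists2 v, inF0 v & u * v = 1.
Proof.
move=> u0; have [|v uv] :=
  @triangular_solve K (fun n j => u (n - j)%N) (1 : fps K).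
  by move=> n; rewrite subnn.
have {}uv : u * Fps v = 1.
  rewrite mulrC; apply: fpsP => n; rewrite -uv coef_fpsM.
  by apply: eq_bigr => j _; rewrite mulrC.
exists (Fps v) => //; apply/eqP => v0.
by have := coef0_fpsM u (Fps v); rewrite uv v0 mulr0; apply/eqP/oner_neq0.
Qed.

Lemma has_level_mulI k f : has_level k f -> injective ( *%R f).
Proof.
case/has_level_mulE=> u /inF0_inv[v _ uv] -> a b e.
have {}e : fpsX ^+ k * a = fpsX ^+ k * b.
  have := congr1 (fun x => x * v) e.
  have E x : fpsX ^+ k * u * x * v = fpsX ^+ k * x * (u * v) by ring.
  by rewrite !E uv !mulr1.
apply: fpsP => n; have := congr1 (fun x : fps K => x (n + k)%N) e.
by rewrite !coef_fpsXnM ltnNge leq_addl /= addnK.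
Qed.

Lemma inF1_comp_inverse F : inF1 F -> exists2 G, inF1 G & comp_inverse F G.
Proof.
(* Every element of [F_1] has a left inverse in [F_1]; two of them in a row
   give a two-sided inverse. *)
have linv (H : fps K) : inF1 H -> exists2 G, inF1 G & fps_comp G H = fpsX.
  move=> H_F1; have H0 := inF1_coef0 H_F1; have H1 := inF1_coef1 H_F1.
  have [|v vH] := @triangular_solve K (fun n j => (H ^+ j) n) fpsX.
    by move=> n; rewrite coef_fps_expn_diag // expf_neq0.
  have {}vH : fps_comp (Fps v) H = fpsX.
    by apply: fpsP => n; rewrite -vH; apply: eq_bigr => j _; rewrite mulrC.
  exists (Fps v) => //; apply/inF1_level; split=> [[|//] _|].
    by have := coef0_fps_comp (Fps v) H; rewrite vH.
  apply/eqP => v1; have := coef1_fps_comp (Fps v) H; rewrite vH v1 mul0r.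
  exact/eqP/oner_neq0.
move=> F_F1; have [G G_F1 GF] := linv _ F_F1; have [H H_F1 HG] := linv _ G_F1.
have [F0 G0] := (inF1_coef0 F_F1, inF1_coef0 G_F1).
exists G; first exact: G_F1.
split; last exact: GF.
rewrite -[F in fps_comp F](fps_compX F0) -HG -(fps_compA H G0 F0).
by rewrite GF fps_compfX.
Qed.

End Levels.

(** * Riordan matrices *)

Section RiordanCalculus.
Variable K : fieldType.
Implicit Types (f g h F G L : fps K).

(** A Riordan matrix acts on generating functions by [h |-> g * h(F)]. *)
Lemma riordan_app g F (v : nat -> K) : F 0%N = 0 ->
  ltmx_app (riordan g F) v =1 g * fps_comp (Fps v) F.
Proof.
move=> F0 i; rewrite coef_fpsM /ltmx_app /riordan.
transitivity (\sum_(j < i.+1) \sum_(m < i.+1) g m * (v j * (F ^+ j) (i - m)%N)).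
  apply: eq_bigr => j _; rewrite coef_fpsM mulr_suml.
  by apply: eq_bigr => m _; rewrite mulrAC -mulrA.
rewrite exchange_big; apply: eq_bigr => m _.
by rewrite -mulr_sumr (@coef_fps_comp _ (Fps v) F _ i.+1) ?ltnS ?leq_subr.
Qed.

Lemma riordan_mul g F h L : F 0%N = 0 ->
  ltmx_mul (riordan g F) (riordan h L) =
  riordan (g * fps_comp h F) (fps_comp L F).
Proof.
move=> F0; apply/funext => i; apply/funext => k.
rewrite [LHS](riordan_app _ (fun j => riordan h L j k)) // /riordan.
by rewrite -mulrA -fps_compXn // -fps_compM.
Qed.

Lemma riordan1X : riordan 1 fpsX = mx_id K.
Proof.
apply/funext => i; apply/funext => j.
by rewrite /riordan mul1r coef_fpsXn.
Qed.

Lemma riordan_inj g F h L : inF0 g -> riordan g F = riordan h L ->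
  g = h /\ F = L.
Proof.
move=> g0 e; have {e} col k : g * F ^+ k = h * L ^+ k.
  by apply: fpsP => n; have := congr1 (fun A => A n k) e.
have g_level : has_level 0 g by [].
split; first by have := col 0%N; rewrite !expr0 !mulr1.
have := col 1%N; have := col 0%N; rewrite !expr0 !mulr1 !expr1 => <-.
by move=> /(has_level_mulI g_level).
Qed.

Lemma riordan_diag g F n : F 0%N = 0 ->
  riordan g F n n = g 0%N * F 1%N ^+ n.
Proof.
case/fpsX_mulE=> f ->.
rewrite /riordan exprMn mulrCA coef_fpsXnM ltnn subnn coef0_fpsM coef_fpsXM.
by congr (_ * _); elim: n => // n IHn; rewrite !exprS coef0_fpsM IHn.
Qed.

Lemma riordan_app_low g F h k : F 0%N = 0 ->
  (forall i, (i < k)%N -> h i = 0) ->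
  (forall i, (i < k)%N -> (g * fps_comp h F) i = 0) /\
  (g * fps_comp h F) k = g 0%N * F 1%N ^+ k * h k.
Proof.
move=> F0 hk; have appE i : (g * fps_comp h F) i = ltmx_app (riordan g F) h i.
  by rewrite riordan_app //; case: h {hk}.
split=> [i ik|]; rewrite appE /ltmx_app.
  rewrite big1 // => j _; rewrite hk ?mulr0 //.
  by apply: leq_ltn_trans ik; rewrite -ltnS.
rewrite big_ord_recr /= riordan_diag // big1 ?add0r // => j _.
by rewrite hk ?mulr0.
Qed.

(** The level of an eigenvector determines its eigenvalue. *)
Lemma level_eigenvectorP g F k h : F 0%N = 0 ->
  level_eigenvector (riordan g F) k h <->
  has_level k h /\
  g * fps_comp h F = fpsC (g 0%N * F 1%N ^+ k) * h.
Proof.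
move=> F0; split=> [[[_ [lambda eig]] hk]|[hk eig]]; last first.
  split=> //; split; first by exists k; case: hk.
  exists (g 0%N * F 1%N ^+ k) => i; rewrite riordan_app //.
  by rewrite -coef_fpsCM -eig; case: (h).
have {}eig : g * fps_comp h F = fpsC lambda * h.
  by apply: fpsP => i; rewrite coef_fpsCM -eig riordan_app //; case: (h).
split=> //; rewrite eig; congr (fpsC _ * _); case: hk => hlt hk.
have [_] := riordan_app_low g F0 hlt.
by rewrite eig coef_fpsCM => /(mulIf hk).
Qed.

End RiordanCalculus.

(** * Rigidity *)

Section FixedSeries.
Variable K : fieldType.
Hypothesis char0 : forall n, n.+1%:R != 0 :> K.
Implicit Types (w G : fps K).

(** If [G = x + a x^(s+1) + ...] with [a != 0], then [w(G) - w] has leading term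
    [d a w_d x^(d+s)]. *)
Lemma fixed_series_comp_id d w G : (0 < d)%N -> has_level d w ->
  G 0%N = 0 -> G 1%N = 1 -> fps_comp w G = w -> G = fpsX.
Proof.
move=> d_gt0 [w_lt wd] G0 G1 wG.
have [u Gu] := fpsX_mulE G0; rewrite Gu coef_fpsXM in G1.
apply: contrapT => GX; have u1 : u - 1 <> 0.
  by move=> /subr0_eq u1; apply: GX; rewrite Gu u1 mulr1.
have [s u_s] := has_level_ex u1.
have s_gt0 : (0 < s)%N.
  by case: s u_s => // -[_]; rewrite coef_fpsD coef_fpsN G1 subrr eqxx.
have [q q0 uq] := has_level_mulE u_s.
have {uq}GE : G = fpsX * (1 + fpsX ^+ s * q) by rewrite -uq addrC subrK.
have powG j : exists2 r : fps K,
    G ^+ j = fpsX ^+ j + fpsX ^+ (j + s) * r & r 0%N = j%:R * q 0%N.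
  (* [r] starts with the binomial term [j q_0] *)
  elim: j => [|j [r Gj r0]].
    by exists 0; rewrite ?mulr0 ?addr0 ?mul0r.
  exists (r + q + fpsX ^+ s * (q * r)).
    rewrite exprS Gj GE addSn !exprS exprD; ring.
  rewrite !coef_fpsD r0 coef_fpsXnM s_gt0 addr0.
  by rewrite -natr1 mulrDl mul1r.
(* Compare the coefficients of [x^(d+s)]: beyond those of [w] itself, only the
   term of degree [d] of [w] contributes to [w(G)]. *)
have term j : w j * (G ^+ j) (d + s)%N =
    (if j == (d + s)%N then w j else 0) +
    (if j == d then w d * (d%:R * q 0%N) else 0).
  have [r -> r0] := powG j; rewrite coef_fpsD coef_fpsXn coef_fpsXnM ltn_add2r.
  rewrite subnDr mulrDr eq_sym.
  case: (ltngtP d j) => [dj|jd|dj].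
  - by rewrite mulr0 !addr0; case: eqP; rewrite ?mulr1 ?mulr0.
  - by rewrite w_lt // !mul0r if_same.
  - by subst j; rewrite subnn r0; case: eqP; rewrite ?mulr1 ?mulr0.
have := congr1 (fun f : fps K => f (d + s)%N) wG.
rewrite fps_compE (eq_bigr _ (fun (j : 'I__) _ => term j)).
rewrite big_split -!big_mkcond /=.
rewrite (big_ord1_eq _ w) (big_ord1_eq _ (fun=> w d * (d%:R * q 0%N))).
rewrite ltnSn ltnS leq_addr -[RHS]addr0 => /addrI /eqP.
rewrite !mulf_eq0 (negPf wd) (negPf q0) orbF /=.
by case: d d_gt0 {w_lt wd powG term wG} => // d _; rewrite (negPf (char0 d)).
Qed.

End FixedSeries.
(** * Powers of a Riordan matrix *)

Section Iteration.
Variable K : fieldType.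
Implicit Types (g h F : fps K).

(** The action of the Riordan matrix [(g, F)] on generating functions of
    column vectors. *)
Definition riordan_op g F h : fps K := g * fps_comp h F.

Lemma riordan_opCM g F (c : K) h : F 0%N = 0 ->
  riordan_op g F (fpsC c * h) = fpsC c * riordan_op g F h.
Proof. by move=> F0; rewrite /riordan_op fps_compM // fps_compC mulrCA. Qed.

Lemma riordan_op_sum g F n (h : nat -> fps K) :
  riordan_op g F (\sum_(i < n) h i) = \sum_(i < n) riordan_op g F (h i).
Proof. by rewrite /riordan_op fps_comp_sum mulr_sumr. Qed.

Lemma fps_iter_coef0 F n : F 0%N = 0 -> (fps_iter F n) 0%N = 0.
Proof. by move=> F0; case: n => // n; rewrite fps_iterS coef0_fps_comp. Qed.

Lemma fps_iter_coef1 F n : (fps_iter F n) 1%N = F 1%N ^+ n.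
Proof. by elim: n => // n IHn; rewrite exprS -IHn fps_iterS coef1_fps_comp. Qed.

Lemma fps_iterSr F n : F 0%N = 0 ->
  fps_iter F n.+1 = fps_comp (fps_iter F n) F.
Proof.
move=> F0; elim: n => [|n IHn].
  by rewrite fps_iterS fps_iter0 (fps_compX F0) fps_compfX.
rewrite [LHS]fps_iterS [in LHS]IHn (fps_compA _ (fps_iter_coef0 n F0) F0).
by rewrite -fps_iterS.
Qed.

Lemma iter_riordan_op g F h n : F 0%N = 0 ->
  iter n (riordan_op g F) h =
  iter n (riordan_op g F) 1 * fps_comp h (fps_iter F n).
Proof.
move=> F0; elim: n => [|n IHn]; first by rewrite mul1r fps_compfX.
have hS :
    fps_comp (fps_comp h (fps_iter F n)) F = fps_comp h (fps_iter F n.+1).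
  by rewrite (fps_iterSr _ F0) (fps_compA _ (fps_iter_coef0 n F0) F0).
rewrite !iterS IHn [LHS]/riordan_op (fps_compM _ _ F0) hS mulrA.
exact: erefl.
Qed.

Lemma riordan_exp g F n : F 0%N = 0 ->
  ltmx_exp (riordan g F) n =
  riordan (iter n (riordan_op g F) 1) (fps_iter F n).
Proof.
move=> F0; elim: n => [|n IHn]; first by rewrite riordan1X.
rewrite [LHS]/= -/(ltmx_exp (riordan g F) n) IHn (riordan_mul _ _ _ F0).
rewrite -(fps_iterSr _ F0); exact: erefl.
Qed.

Lemma iter_riordan_op_coef0 g F n : g 0%N = 1 ->
  (iter n (riordan_op g F) 1) 0%N = 1.
Proof.
move=> g0; elim: n => // n IHn.
by rewrite iterS coef0_fpsM coef0_fps_comp g0 IHn mulr1.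
Qed.

Lemma iter_riordan_op_eigen g F h (c : K) n : F 0%N = 0 ->
  riordan_op g F h = fpsC c * h ->
  iter n (riordan_op g F) h = fpsC (c ^+ n) * h.
Proof.
move=> F0 eig; elim: n => [|n IHn]; first by rewrite mul1r.
by rewrite iterS IHn riordan_opCM // eig mulrA -rmorphM -exprSr.
Qed.

Lemma iter_riordan_op1 F n : iter n (riordan_op 1 F) 1 = 1.
Proof.
by elim: n => // n IHn; rewrite iterS IHn /riordan_op fps_comp1 mulr1.
Qed.

Lemma iter_riordan_op_low g F k n : F 0%N = 0 -> g 0%N = 1 ->
  let h := iter n (riordan_op g F) (fpsX ^+ k) in
  (forall i, (i < k)%N -> h i = 0) /\ h k = F 1%N ^+ (k * n).
Proof.
move=> F0 g0; elim: n => [|n [IHlt IHk]].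
  split=> [i ik|]; first by rewrite coef_fpsXn ltn_eqF.
  by rewrite coef_fpsXn eqxx muln0.
have [hlt hk] := riordan_app_low g F0 IHlt.
by split=> //; rewrite [LHS]hk IHk g0 mul1r mulnS exprD.
Qed.

End Iteration.

(** * Construction of eigenvectors *)

Section EigenvectorConstruction.
Variable K : fieldType.
Implicit Types (g h F : fps K).

(** The eigenvector is the sum of [f_1^(-ki) (g, F)^i x^k] over [i < m]. *)
Lemma finite_order_level_eigen (char0 : forall n, n.+1%:R != 0 :> K)
    g F m k : inF1 F -> g 0%N = 1 -> (0 < m)%N ->
  iter m (riordan_op g F) 1 = 1 -> fps_iter F m = fpsX ->
  exists2 h : fps K, has_level k h & riordan_op g F h = fpsC (F 1%N ^+ k) * h.
Proof.
move=> F_F1 g0 m_gt0 gm Fm; have F0 := inF1_coef0 F_F1.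
have f1_neq0 := inF1_coef1 F_F1; set c := F 1%N ^+ k.
have c_neq0 : c != 0 by rewrite expf_neq0.
have cm : c ^+ m = 1 by rewrite exprAC -fps_iter_coef1 Fm expr1n.
pose T i := iter i (riordan_op g F) (fpsX ^+ k).
pose t i := fpsC (c ^- i) * T i.
exists (\sum_(i < m) t i).
  split=> [i ik|].
    rewrite coef_fps_sum big1 // => j _; rewrite coef_fpsCM.
    have [T_lt _] := iter_riordan_op_low k j F0 g0.
    by rewrite [T j i](T_lt i ik) mulr0.
  rewrite coef_fps_sum (eq_bigr (fun=> 1)) => [|j _].
    by rewrite sumr_const card_ord; case: m m_gt0 {gm Fm cm} => // m _.
  rewrite coef_fpsCM; have [_ T_k] := iter_riordan_op_low k j F0 g0.
  rewrite [T j k]T_k.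
  by rewrite exprM mulVf // expf_neq0.
have tS i : riordan_op g F (t i) = fpsC c * t i.+1.
  by rewrite (riordan_opCM _ _ _ F0) [RHS]mulrA -rmorphM exprS invfM mulVKf.
rewrite riordan_op_sum (eq_bigr (fun i : 'I_m => fpsC c * t i.+1)) //.
rewrite -mulr_sumr; congr (_ * _).
have t_m : t m = t 0%N.
  rewrite /t /T cm expr0 (iter_riordan_op _ _ m F0) gm Fm fps_compfX mul1r.
  exact: erefl.
apply: (@addrI _ (t 0%N)); transitivity (\sum_(i < m.+1) t i).
  by rewrite big_ord_recl; exact: erefl.
by rewrite big_ord_recr t_m addrC.
Qed.

(** The diagonal entries [g_0 f_1^n] are distinct, so the equation determines
   the coefficients beyond [x^k] one after the other. *)
Lemma infinite_order_level_eigen g F k : inF0 g -> inF1 F ->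
  infinite_order (mul_trivial (F 1%N)) ->
  exists2 h : fps K,
    has_level k h & riordan_op g F h = fpsC (g 0%N * F 1%N ^+ k) * h.
Proof.
move=> g0 F_F1 f1_inf; have F0 := inF1_coef0 F_F1.
have f1_neq0 := inF1_coef1 F_F1; set c := g 0%N * _.
(* Rows up to [k] impose the initial coefficients [0, ..., 0, 1]; those beyond
   [k] are the rows of the eigenvector equation. *)
pose A n j := if (n <= k)%N then (j == n)%:R
              else riordan g F n j - c * (j == n)%:R.
have [n|v Av] := @triangular_solve K A (fun n => (n == k)%:R).
  rewrite /A eqxx; case: leqP => [_|kn]; first exact: oner_neq0.
  rewrite riordan_diag // mulr1 -mulrBr mulf_neq0 // subr_eq0.
  rewrite -(subnK (ltnW kn)) exprD -subr_eq0 -[X in _ - X]mul1r -mulrBl.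
  rewrite mulf_neq0 ?expf_neq0 // subr_eq0; apply/eqP => f1_triv.
  by apply: f1_inf; exists (n - k)%N; rewrite subn_gt0.
have sum_delta n : \sum_(j < n.+1) (j == n :> nat)%:R * v j = v n.
  rewrite (eq_bigr (fun j : 'I_n.+1 => if j == n :> nat then v j else 0)).
    by rewrite -big_mkcond (big_ord1_eq _ v) ltnSn.
  by move=> j _; case: eqP; rewrite ?mul1r ?mul0r.
have v_le n : (n <= k)%N -> v n = (n == k)%:R.
  by move=> nk; rewrite -(Av n) /A nk sum_delta.
have v_lt i : (i < k)%N -> Fps v i = 0.
  by move=> ik; rewrite /= v_le ?ltn_eqF // ltnW.
exists (Fps v); first by split; rewrite //= v_le ?eqxx ?oner_neq0.
have [Tlt Tk] := riordan_app_low g F0 v_lt.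
apply: fpsP => n; rewrite coef_fpsCM; case: (ltngtP n k) => [nk|kn|->].
- by rewrite [LHS]Tlt // v_lt // mulr0.
- rewrite -[LHS](riordan_app g v F0); apply/eqP.
  rewrite -subr_eq0 /= -(sum_delta n) mulr_sumr -sumrB.
  have := Av n; rewrite (gtn_eqF kn) /A leqNgt kn /= => Avn.
  rewrite -[X in _ == X]Avn; apply/eqP; apply: eq_bigr => j _.
  by rewrite mulrBl mulrA.
- exact: Tk.
Qed.

End EigenvectorConstruction.

(** * Linearization *)

Lemma exists_order (P : nat -> Prop) n : (0 < n)%N -> P n ->
  exists m, is_order P m.
Proof.
move=> n_gt0 Pn.
have exP : exists m, (0 < m)%N && `[< P m >].
  by exists n; rewrite n_gt0; apply/asboolP.
exists (ex_minn exP); case: ex_minnP => m /andP[m_gt0 /asboolP Pm] m_min.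
by split=> // l l_gt0 Pl; apply: m_min; rewrite l_gt0; apply/asboolP.
Qed.

Section Linearization.
Variable K : fieldType.
Hypothesis char0 : forall n, n.+1%:R != 0 :> K.
Implicit Types (g h u w F theta : fps K).

(** The compositional inverse of [theta] always exists, so only the equation
    [theta(F) = f_1 theta] matters. *)
Lemma linearizableP F : inF1 F -> linearizable F <->
  exists2 theta : fps K, inF1 theta & fps_comp theta F = fpsC (F 1%N) * theta.
Proof.
move=> F_F1; have F0 := inF1_coef0 F_F1; split.
  case=> theta [eta [theta_F1 eta_F1 [_ eta_theta] lin]]; exists theta => //.
  have theta0 := inF1_coef0 theta_F1; have eta0 := inF1_coef0 eta_F1.
  have F_eta0 : (fps_comp F eta) 0%N = 0 by rewrite coef0_fps_comp.
  have := congr1 (fun f => fps_comp f theta) lin.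
  rewrite (fps_compM _ _ theta0) fps_compC (fps_compX theta0).
  rewrite -(fps_compA _ F_eta0 theta0) -(fps_compA _ eta0 theta0) eta_theta.
  by rewrite fps_compfX.
case=> theta theta_F1 lin; have theta0 := inF1_coef0 theta_F1.
have [eta eta_F1 [theta_eta eta_theta]] := inF1_comp_inverse theta_F1.
exists theta, eta; split=> //.
rewrite fps_compA ?inF1_coef0 // lin fps_compM ?inF1_coef0 //.
by rewrite fps_compC theta_eta.
Qed.

(** The [m]-th iterate of [F] fixes [w] and has linear coefficient [1]. *)
Lemma fps_iter_eq_id d w F m : (0 < d)%N -> has_level d w -> F 0%N = 0 ->
  fps_comp w F = fpsC (F 1%N ^+ d) * w -> F 1%N ^+ m = 1 ->
  fps_iter F m = fpsX.
Proof.
move=> d_gt0 wd F0 wF f1m.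
apply: (fixed_series_comp_id char0 d_gt0 wd).
- exact: fps_iter_coef0.
- by rewrite fps_iter_coef1.
have := iter_riordan_op 1 w m F0; rewrite iter_riordan_op1 mul1r => <-.
have wF1 : riordan_op 1 F w = fpsC (F 1%N ^+ d) * w.
  by rewrite /riordan_op mul1r.
by rewrite (iter_riordan_op_eigen _ F0 wF1) exprAC f1m expr1n mul1r.
Qed.

Lemma finite_comp_order_linearize F m : inF1 F -> (0 < m)%N ->
  fps_iter F m = fpsX ->
  exists2 theta : fps K, inF1 theta & fps_comp theta F = fpsC (F 1%N) * theta.
Proof.
move=> F_F1 m_gt0 Fm.
have [theta /inF1_level theta_F1] := finite_order_level_eigen char0 1 F_F1
  (erefl : (1 : fps K) 0%N = 1) m_gt0 (iter_riordan_op1 F m) Fm.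
by rewrite /riordan_op mul1r expr1; exists theta.
Qed.

Lemma level_eigen_linearizable d w F : (0 < d)%N -> has_level d w -> inF1 F ->
  fps_comp w F = fpsC (F 1%N ^+ d) * w -> linearizable F.
Proof.
move=> d_gt0 wd F_F1 wF; apply/linearizableP => //.
have F0 := inF1_coef0 F_F1.
have [[m [m_gt0 f1m]]|f1_inf] :=
  pselect (exists n, (0 < n)%N /\ mul_trivial (F 1%N) n).
  exact: finite_comp_order_linearize m_gt0 (fps_iter_eq_id d_gt0 wd F0 wF f1m).
have one_F0 : inF0 (1 : fps K) by exact: oner_neq0.
have [theta /inF1_level theta_F1] :=
  infinite_order_level_eigen 1 one_F0 F_F1 f1_inf.
by rewrite /riordan_op !mul1r expr1; exists theta.
Qed.

End Linearization.
(** * Eigenvectors of a Riordan matrix *)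

Section RiordanEigenvectors.
Variable K : fieldType.
Hypothesis char0 : forall n, n.+1%:R != 0 :> K.
Implicit Types (g h u w F theta : fps K).

Lemma eigenvector_level g F (v : nat -> K) : F 0%N = 0 ->
  eigenvector (riordan g F) v -> exists k, level_eigenvector (riordan g F) k v.
Proof.
move=> F0 eig; have [n vn] := eig.1.
have [|k vk] := @has_level_ex K (Fps v); last by exists k.
by move=> v0; case/eqP: vn; have := congr1 (fun f : fps K => f n) v0.
Qed.

(** If both vectors have the same level, hence the same eigenvalue, a
   combination of them has a higher one. *)
Lemma lin_indep2_levels g F (u v : nat -> K) : F 0%N = 0 ->
  eigenvector (riordan g F) u -> eigenvector (riordan g F) v ->
  lin_indep2 u v ->
  exists j k (u' v' : nat -> K), [/\ (j < k)%N,
    level_eigenvector (riordan g F) j u' &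
    level_eigenvector (riordan g F) k v'].
Proof.
move=> F0 /(eigenvector_level F0)[j uj] /(eigenvector_level F0)[k vk] uv.
have [jk|kj|jk] := ltngtP j k; first by exists j, k, u, v.
  by exists k, j, v, u.
subst k; have [u_lev u_eig] := (level_eigenvectorP g j (Fps u) F0).1 uj.
have [v_lev v_eig] := (level_eigenvectorP g j (Fps v) F0).1 vk.
have [[u_lt u_j] [v_lt v_j]] := (u_lev, v_lev).
pose c := - (v j / u j); pose w := Fps v + fpsC c * Fps u.
have w_coef i : w i = c * u i + 1 * v i.
  by rewrite coef_fpsD coef_fpsCM mul1r addrC.
have [|l wl] := @has_level_ex K w.
  move=> w0; have [i|_ /eqP] := uv c 1; last by rewrite oner_eq0.
  by rewrite -w_coef w0.
have w_j : w j = 0 by rewrite w_coef mul1r mulNr divfK // addNr.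
exists j, l, u, w; split=> //.
  rewrite ltnNge; apply/negP => lj; case: wl => _ /eqP; apply.
  move: lj; rewrite leq_eqVlt => /orP[/eqP -> //|lj].
  by rewrite w_coef [u l]u_lt // [v l]v_lt // !mulr0 addr0.
split; last exact: wl.
split; first by exists l; case: wl.
exists (g 0%N * F 1%N ^+ j) => i; rewrite riordan_app // -coef_fpsCM.
congr (coefs _ i); rewrite /w fps_compD (fps_compM _ _ F0) fps_compC !mulrDr.
by rewrite v_eig mulrCA u_eig mulrCA.
Qed.

Lemma two_levels_linearizable g F j k (u v : nat -> K) : inF0 g -> inF1 F ->
  (j < k)%N -> level_eigenvector (riordan g F) j u ->
  level_eigenvector (riordan g F) k v -> linearizable F.
Proof.
move=> g0 F_F1 jk uj vk; have F0 := inF1_coef0 F_F1.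
have [u_lev u_eig] := (level_eigenvectorP g j (Fps u) F0).1 uj.
have [v_lev v_eig] := (level_eigenvectorP g k (Fps v) F0).1 vk.
have [u1 u1_F0 uE] := has_level_mulE u_lev.
have [v1 v1_F0 vE] := has_level_mulE v_lev.
have [u2 u2_F0 u12] := inF0_inv u1_F0.
(* [w] is the quotient [v / u]. *)
pose w := fpsX ^+ (k - j) * (v1 * u2).
have vu : Fps v = Fps u * w.
  rewrite vE uE /w -{1}(subnK (ltnW jk)) exprD -[v1 in LHS]mulr1 -u12.
  by ring.
have w_lev : has_level (k - j) w.
  split=> [i ikj|]; first by rewrite coef_fpsXnM ikj.
  by rewrite coef_fpsXnM ltnn subnn coef0_fpsM mulf_neq0.
apply: (level_eigen_linearizable char0 _ w_lev F_F1); first by rewrite subn_gt0.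
apply: (has_level_mulI u_lev).
have c_lev : has_level 0 (fpsC (g 0%N * F 1%N ^+ j)).
  by split=> //; rewrite mulf_neq0 // expf_neq0 // inF1_coef1.
apply: (has_level_mulI c_lev).
rewrite [LHS]mulrA -u_eig -[LHS]mulrA -(fps_compM _ _ F0) -vu v_eig vu.
rewrite -(subnKC (ltnW jk)) exprD mulrA rmorphM subnKC ?(ltnW jk) //.
by ring.
Qed.

(** The primary eigenvector is [v / theta^k]. *)
Lemma primary_of_level_eigen g F k theta (v : nat -> K) :
  inF1 F -> inF1 theta -> fps_comp theta F = fpsC (F 1%N) * theta ->
  level_eigenvector (riordan g F) k v ->
  exists v0, primary_eigenvector (riordan g F) v0.
Proof.
move=> F_F1 /inF1_level theta1 lin vk; have F0 := inF1_coef0 F_F1.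
have [v_lev v_eig] := (level_eigenvectorP g k (Fps v) F0).1 vk.
have thetak : has_level k (theta ^+ k).
  by have := has_levelXn k theta1; rewrite mul1n.
have [t t_F0 tE] := has_level_mulE thetak.
have [v1 v1_F0 vE] := has_level_mulE v_lev.
have [t' t'_F0 tt'] := inF0_inv t_F0.
have vt : Fps v = theta ^+ k * (v1 * t').
  by rewrite vE tE -[v1 in LHS]mulr1 -tt'; ring.
exists (v1 * t'); apply/level_eigenvectorP => //; split.
  by split=> //; rewrite coef0_fpsM mulf_neq0.
rewrite expr0 mulr1; apply: (has_level_mulI thetak).
have c_lev : has_level 0 (fpsC (F 1%N ^+ k)).
  by split=> //; rewrite expf_neq0 // inF1_coef1.
apply: (has_level_mulI c_lev).
move: v_eig; rewrite vt (fps_compM _ _ F0) (fps_compXn _ _ F0) lin exprMn.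
rewrite -rmorphXn rmorphM => e.
rewrite [RHS](_ : _ = fpsC (g 0%N) * fpsC (F 1%N ^+ k) *
  (theta ^+ k * (v1 * t'))); last by ring.
by rewrite -e; ring.
Qed.

(** [(h, theta)] conjugates [(g, F)] to [(g_0, f_1 x)] exactly when [h] is a
    primary eigenvector and [theta] linearizes [F]. *)
Lemma diagonalizationP g F : inF0 g -> inF1 F ->
  (exists (h theta : fps K) (B : nat -> nat -> K),
     [/\ inF0 h, inF1 theta, riordan_inverse (riordan h theta) B &
         ltmx_mul (ltmx_mul B (riordan g F)) (riordan h theta)
         = riordan (fpsC (g 0%N)) (fpsC (F 1%N) * fpsX)]) <->
  (exists h theta, [/\ inF0 h, inF1 theta,
     g * fps_comp h F = fpsC (g 0%N) * h &
     fps_comp theta F = fpsC (F 1%N) * theta]).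
Proof.
move=> g0 F_F1; have F0 := inF1_coef0 F_F1; split.
  case=> h [theta [B [h_F0 theta_F1 [[b [L [b_F0 L_F1 ->]]] hB _]]]].
  have [theta0 L0] := (inF1_coef0 theta_F1, inF1_coef0 L_F1).
  have FL0 : (fps_comp F L) 0%N = 0 by rewrite coef0_fps_comp.
  rewrite (riordan_mul _ _ _ L0) (riordan_mul _ _ _ FL0) => diag.
  move: hB; rewrite (riordan_mul _ _ _ theta0) -riordan1X => hB.
  have hb_F0 : inF0 (h * fps_comp b theta).
    by rewrite /inF0 coef0_fpsM coef0_fps_comp mulf_neq0.
  have [hb L_theta] := riordan_inj hb_F0 hB.
  have bgh_F0 : inF0 (b * fps_comp g L * fps_comp h (fps_comp F L)).
    by rewrite /inF0 !coef0_fpsM !coef0_fps_comp !mulf_neq0.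
  have [diag1 diag2] := riordan_inj bgh_F0 diag.
  (* Composing both identities with [theta] on the right undoes [L]. *)
  have comp_theta f : fps_comp (fps_comp f L) theta = f.
    by rewrite -(fps_compA _ L0 theta0) L_theta fps_compfX.
  have comp2_theta f :
      fps_comp (fps_comp f (fps_comp F L)) theta = fps_comp f F.
    by rewrite -(fps_compA _ FL0 theta0) comp_theta.
  exists h, theta; split; [exact: h_F0 | exact: theta_F1 | |].
    have := congr1 (fun f => h * fps_comp f theta) diag1.
    rewrite !(fps_compM _ _ theta0) comp_theta comp2_theta fps_compC.
    by rewrite !mulrA hb mul1r [RHS]mulrC.
  have := congr1 (fun f => fps_comp f theta) diag2.
  by rewrite comp2_theta (fps_compM _ _ theta0) fps_compC (fps_compX theta0).
case=> h [theta [h_F0 theta_F1 h_eig lin]].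
have [eta eta_F1 [theta_eta eta_theta]] := inF1_comp_inverse theta_F1.
have [theta0 eta0] := (inF1_coef0 theta_F1, inF1_coef0 eta_F1).
have [h' h'_F0 hh'] := inF0_inv h_F0.
have inv_l :
    ltmx_mul (riordan (fps_comp h' eta) eta) (riordan h theta) = mx_id K.
  rewrite (riordan_mul _ _ _ eta0) -(fps_compM _ _ eta0) mulrC hh' fps_comp1.
  by rewrite theta_eta riordan1X.
have b_F0 : inF0 (fps_comp h' eta) by rewrite /inF0 coef0_fps_comp.
exists h, theta, (riordan (fps_comp h' eta) eta).
split; [exact: h_F0 | exact: theta_F1 | split; last exact: inv_l |].
    by exists (fps_comp h' eta), eta.
  rewrite (riordan_mul _ _ _ theta0) -(fps_compA _ eta0 theta0) eta_theta.
  by rewrite fps_compfX hh' riordan1X.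
have Feta0 : (fps_comp F eta) 0%N = 0 by rewrite coef0_fps_comp.
rewrite (riordan_mul _ _ _ eta0) (riordan_mul _ _ _ Feta0).
rewrite !(fps_compA _ F0 eta0) lin -mulrA -(fps_compM _ _ eta0) h_eig.
rewrite mulrC -(fps_compM _ _ eta0) -mulrA hh' mulr1 fps_compC.
by rewrite (fps_compM _ _ eta0) fps_compC theta_eta.
Qed.

Lemma normalized_level_eigen g F k h : g 0%N != 0 ->
  (g * fps_comp h F = fpsC (g 0%N * F 1%N ^+ k) * h) <->
  (riordan_op (fpsC (g 0%N)^-1 * g) F h = fpsC (F 1%N ^+ k) * h).
Proof.
move=> g0; rewrite /riordan_op -mulrA; split=> [->|e].
  by rewrite mulrA -rmorphM mulKf.
by rewrite rmorphM -mulrA -e mulrA -rmorphM divff // mul1r.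
Qed.

(** Averaging the iterates of [F] linearizes it, so its [m]-th iterate is
    already [x] by rigidity; the [m]-th power of [(g / g_0, F)] is then [(r, x)]
    for some [r], and [r * v = f_1^(km) v = v]. *)
Lemma finite_order_of_level_eigen g F m n k (v : nat -> K) :
  inF0 g -> inF1 F -> (0 < n)%N -> fps_iter F n = fpsX ->
  is_order (mul_trivial (F 1%N)) m ->
  level_eigenvector (riordan g F) k v ->
  is_order (mx_trivial (riordan (fpsC (g 0%N)^-1 * g) F)) m.
Proof.
move=> g0 F_F1 n_gt0 Fn [m_gt0 f1m m_min] vk; have F0 := inF1_coef0 F_F1.
have [v_lev v_eig] := (level_eigenvectorP g k (Fps v) F0).1 vk.
set ghat := fpsC _ * g; have ghat0 : ghat 0%N = 1 by rewrite coef_fpsCM mulVf.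
have [theta theta_F1 lin] := finite_comp_order_linearize char0 F_F1 n_gt0 Fn.
have Fm : fps_iter F m = fpsX.
  have /inF1_level theta_lev := theta_F1.
  exact: (fps_iter_eq_id char0 (ltn0Sn 0) theta_lev F0 lin f1m).
split; [exact: m_gt0 | | move=> l l_gt0].
  rewrite /mx_trivial (riordan_exp _ _ F0) Fm -riordan1X; congr riordan.
  apply: (has_level_mulI v_lev); rewrite mulr1 mulrC.
  have /(iter_riordan_op_eigen m F0) :=
    (normalized_level_eigen F k (Fps v) g0).1 v_eig.
  by rewrite (iter_riordan_op _ _ _ F0) Fm fps_compfX exprAC f1m expr1n mul1r.
rewrite /mx_trivial (riordan_exp _ _ F0) -riordan1X => triv.
apply: (m_min l l_gt0).
have gl_F0 : inF0 (iter l (riordan_op ghat F) 1).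
  by rewrite /inF0 (iter_riordan_op_coef0 _ _ ghat0) oner_neq0.
have [_ Fl] := riordan_inj gl_F0 triv.
by rewrite /mul_trivial -fps_iter_coef1 Fl.
Qed.

Lemma finite_order_full_set g F m : inF0 g -> inF1 F ->
  is_order (mx_trivial (riordan (fpsC (g 0%N)^-1 * g) F)) m ->
  full_set_of_eigenvectors (riordan g F).
Proof.
move=> g0 F_F1 [m_gt0 triv _]; have F0 := inF1_coef0 F_F1.
set ghat := fpsC _ * g in triv.
have ghat0 : ghat 0%N = 1 by rewrite coef_fpsCM mulVf.
have gm_F0 : inF0 (iter m (riordan_op ghat F) 1).
  by rewrite /inF0 (iter_riordan_op_coef0 _ _ ghat0) oner_neq0.
move: triv; rewrite /mx_trivial (riordan_exp _ _ F0) -riordan1X => triv.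
have [gm Fm] := riordan_inj gm_F0 triv.
suff /choice[v vP] : forall k, exists v : nat -> K,
    level_eigenvector (riordan g F) k v by exists v.
move=> k.
have [h h_lev h_eig] := finite_order_level_eigen char0 k F_F1 ghat0 m_gt0 gm Fm.
exists h; apply/(level_eigenvectorP _ _ _ F0); split; first exact: h_lev.
exact/normalized_level_eigen.
Qed.

Lemma infinite_order_full_set g F : inF0 g -> inF1 F ->
  infinite_order (mul_trivial (F 1%N)) ->
  full_set_of_eigenvectors (riordan g F).
Proof.
move=> g0 F_F1 f1_inf; have F0 := inF1_coef0 F_F1.
suff /choice[v vP] : forall k, exists v : nat -> K,
    level_eigenvector (riordan g F) k v by exists v.
move=> k.
have [h h_lev h_eig] := infinite_order_level_eigen k g0 F_F1 f1_inf.
by exists h; apply/level_eigenvectorP.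
Qed.

End RiordanEigenvectors.

Lemma real_or_complex_char0 (K : fieldType) : real_or_complex K ->
  forall n, n.+1%:R != 0 :> K.
Proof. by case=> R n; rewrite Num.Theory.pnatr_eq0. Qed.

Theorem theorem3p10 (K : fieldType) (hK : real_or_complex K)
    (g F : fps K) (hg : inF0 g) (hF : inF1 F) :
  let A := riordan g F in
  let g0 := g 0%N in
  let f1 := F 1%N in
  let ghat := fpsC g0^-1 * g in
  [<->
    (* (a) *) full_set_of_eigenvectors A;
    (* (b) *) exists u v : nat -> K,
                [/\ eigenvector A u, eigenvector A v & lin_indep2 u v];
    (* (c) *) (exists k v, (0 < k)%N /\ level_eigenvector A k v)
              /\ linearizable F;
    (* (d) *) (exists v, primary_eigenvector A v) /\ linearizable F;
    (* (e) *) exists (h theta : fps K) (B : nat -> nat -> K),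
                [/\ inF0 h, inF1 theta,
                    riordan_inverse (riordan h theta) B &
                    ltmx_mul (ltmx_mul B A) (riordan h theta)
                    = riordan (fpsC g0) (fpsC f1 * fpsX)];
    (* (f) *) (exists k v, level_eigenvector A k v)
              /\ ((exists n, is_order (comp_trivial F) n)
                  \/ infinite_order (mul_trivial f1));
    (* (g) *) infinite_order (mul_trivial f1)
              \/ exists n, is_order (mx_trivial (riordan ghat F)) n
                           /\ is_order (mul_trivial f1) n ].
Proof.
move=> A g0 f1 ghat; have char0 := real_or_complex_char0 hK.
have F0 := inF1_coef0 hF; tfae.
- case=> v v_eig; have [eig0 [_ v00]] := v_eig 0%N.
  have [eig1 [v1_lt v11]] := v_eig 1%N.
  exists (v 0%N), (v 1%N); split=> // a b ab.
  have a0 : a = 0.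
    have /eqP := ab 0%N; rewrite v1_lt // mulr0 addr0 mulf_eq0 (negPf v00) orbF.
    by move/eqP.
  split; first exact: a0.
  have /eqP := ab 1%N; rewrite a0 mul0r add0r mulf_eq0 (negPf v11) orbF.
  by move/eqP.
- case=> u [v [u_eig v_eig uv]].
  have [j [k [u' [v' [jk u'j v'k]]]]] := lin_indep2_levels F0 u_eig v_eig uv.
  split; last exact: (two_levels_linearizable char0 hg hF jk u'j v'k).
  by exists k, v'; split; [exact: (leq_ltn_trans (leq0n _) jk) | exact: v'k].
- case=> -[k [v [_ vk]]] lin; split; last exact: lin.
  have [theta theta_F1 theta_F] := (linearizableP hF).1 lin.
  exact: (primary_of_level_eigen hF theta_F1 theta_F vk).
- case=> -[v v_prim] lin; apply/diagonalizationP => //.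
  have [theta theta_F1 theta_F] := (linearizableP hF).1 lin.
  have [v_lev v_eig] := (level_eigenvectorP g 0 (Fps v) F0).1 v_prim.
  exists (Fps v), theta; split; [exact: v_lev.2 | exact: theta_F1 | |].
    by move: v_eig; rewrite expr0 mulr1.
  exact: theta_F.
- move=> /(diagonalizationP hg hF)[h [theta [h_F0 theta_F1 h_eig theta_F]]].
  split.
    exists 0%N, h; apply/(level_eigenvectorP _ _ _ F0); split=> //.
    by rewrite expr0 mulr1.
  have [[n [n_gt0 f1n]]|f1_inf] :=
    pselect (exists n, (0 < n)%N /\ mul_trivial f1 n); last by right.
  left; apply: (exists_order n_gt0).
  have /inF1_level theta_lev := theta_F1.
  exact: (fps_iter_eq_id char0 (ltn0Sn 0) theta_lev F0 theta_F f1n).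
- case=> -[k [v vk]] [[n [n_gt0 Fn _]]|]; last by left.
  have f1n : mul_trivial f1 n by rewrite /mul_trivial -fps_iter_coef1 Fn.
  have [m m_ord] := exists_order n_gt0 f1n; right; exists m; split=> //.
  exact: (finite_order_of_level_eigen char0 hg hF n_gt0 Fn m_ord vk).
- case=> [f1_inf|[m [m_ord _]]]; first exact: infinite_order_full_set.
  exact: (finite_order_full_set char0 hg hF m_ord).
Qed.
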